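(* Let $F_1=\{f_1,\dots,f_\mu\}$ and $F_2=\{f_{\mu+1},\dots,f_\nu\}$ be two ordered finite sets of mappings $f_k:\mathbb{R}^m\times\mathbb{R}^m\to\mathscr{I}^{p,q}$, all of which are bilinear (over $\mathbb{R}$). Let $0\neq a\in\mathbb{R}$ and let $A,B:\mathbb{R}^m\to C\ell_{p,q}$ be two multivector fields with $A(x)=B(ax)$ for all $x\in\mathbb{R}^m$. Then for all $u\in\mathbb{R}^m$ $$\mathcal{F}_{F_1,F_2}(A)(u)=|a|^{-m}\,\mathcal{F}_{F_1,F_2}(B)\!\left(\frac{u}{a}\right).$$
   Context: $C\ell_{p,q}$, $p+q=n\in\mathbb{N}$, is the real associative unital geometric (Clifford) algebra of dimension $2^n$ generated by $e_1,\dots,e_n$ with $e_je_k+e_ke_j=2\epsilon_j\delta_{jk}$, $\epsilon_j=1$ for $j\le p$, $\epsilon_j=-1$ for $j>p$. Its elements are called multivectors; a multivector field is a map $\mathbb{R}^m\to C\ell_{p,q}$. The exponential of a multivector is $e^{A}=\sum_{j\ge0}A^j/j!$. $\mathscr{I}^{p,q}=\{0\}\cup\{i\in C\ell_{p,q}: i^2 \text{ is a negative real number}\}$. For ordered finite sets $F_1=\{f_1,\dots,f_\mu\}$, $F_2=\{f_{\mu+1},\dots,f_\nu\}$ of mappings $f_k:\mathbb{R}^m\times\mathbb{R}^m\to\mathscr{I}^{p,q}$, the geometric Fourier transform (GFT) of $A$ is $$\mathcal{F}_{F_1,F_2}(A)(u)=\int_{\mathbb{R}^m}\prod_{f\in F_1}e^{-f(x,u)}\,A(x)\prod_{f\in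 F_2}e^{-f(x,u)}\,d^mx,\qquad u\in\mathbb{R}^m,$$ where products are taken from left to right in increasing order of the index and an empty product is $1$. All multivector fields are assumed to be such that the integrals defining the transforms in the statement exist. *)

(* Defs.v *)
From HB Require Import structures.
From mathcomp Require Import all_boot all_order all_algebra.
From mathcomp Require Import all_classical all_reals all_analysis.

Set Implicit Arguments.
Unset Strict Implicit.
Unset Printing Implicit Defensive.

Import Order.TTheory GRing.Theory Num.Theory.
Import numFieldNormedType.Exports.

Local Open Scope classical_set_scope.
Local Open Scope ring_scope.

Section BladeCombinatorics.
Variables p q : nat.
Local Notation idx := 'I_(p + q).

Definition symdiff (S T : {set idx}) : {set idx} := (S :\: T) :|: (T :\: S).

Lemma in_symdiff S T i : (i \in symdiff S T) = (i \in S) (+) (i \in T).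
Proof. by rewrite !inE; case: (i \in S); case: (i \in T). Qed.

Lemma symdiffA : associative symdiff.
Proof. by move=> S T U; apply/setP => i; rewrite !in_symdiff addbA. Qed.

Lemma symdiff0s S : symdiff finset.set0 S = S.
Proof. by apply/setP => i; rewrite in_symdiff inE. Qed.

Lemma symdiffs0 S : symdiff S finset.set0 = S.
Proof. by apply/setP => i; rewrite in_symdiff inE addbF. Qed.

Lemma symdiffss S : symdiff S S = finset.set0.
Proof. by apply/setP => i; rewrite in_symdiff inE addbb. Qed.

Variable R : realType.

(* Indices start at 0, so that [e_j ^ 2 = 1] for [j < p]. *)
Definition signature (j : idx) : R := if (j < p)%N then 1 else -1.

(* Factor picked up by the pair (e_i, e_j) when the product of the two ordered
   monomials e_S, i in S, and e_T, j in T, is brought into increasing order. *)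
Definition pair_sign (i j : idx) : R :=
  if (j < i)%N then -1 else if i == j then signature i else 1.

Definition blade_sign (S T : {set idx}) : R :=
  \prod_(i in S) \prod_(j in T) pair_sign i j.

Lemma pair_signK i j : pair_sign i j * pair_sign i j = 1.
Proof.
rewrite /pair_sign /signature.
by do 3?case: ifP => _; rewrite ?mulrNN mulr1.
Qed.

Lemma prod_symdiff (F : idx -> R) S T : (forall i, F i * F i = 1) ->
  \prod_(i in symdiff S T) F i = (\prod_(i in S) F i) * \prod_(i in T) F i.
Proof.
move=> FK; rewrite [LHS]big_mkcond [X in X * _]big_mkcond.
rewrite [X in _ * X]big_mkcond -big_split /=; apply: eq_bigr => i _.
by rewrite in_symdiff; case: (i \in S); case: (i \in T);
  rewrite /= ?FK ?mulr1 ?mul1r.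
Qed.

Lemma blade_sign_symdiffl S T U :
  blade_sign (symdiff S T) U = blade_sign S U * blade_sign T U.
Proof.
rewrite /blade_sign prod_symdiff // => i.
by rewrite -big_split /= big1 // => j _; rewrite pair_signK.
Qed.

Lemma blade_sign_symdiffr S T U :
  blade_sign S (symdiff T U) = blade_sign S T * blade_sign S U.
Proof.
rewrite /blade_sign -big_split /=; apply: eq_bigr => i _.
by rewrite prod_symdiff // => j; rewrite pair_signK.
Qed.

Lemma blade_sign0s S : blade_sign finset.set0 S = 1.
Proof. by rewrite /blade_sign big_set0. Qed.

Lemma blade_signs0 S : blade_sign S finset.set0 = 1.
Proof. by rewrite /blade_sign big1 // => i _; rewrite big_set0. Qed.

Lemma blade_sign11 i j : blade_sign [set i]%SET [set j]%SET = pair_sign i j.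
Proof. by rewrite /blade_sign !big_set1. Qed.

End BladeCombinatorics.

(* A multivector is the vector of its 2 ^ (p + q) coordinates in the basis of
   the monomials e_S (the product of the e_i, i in S, in increasing order). As
   a row vector it inherits the topology used for the exponential series. *)
Definition clifford (R : realType) (p q : nat) : Type :=
  'rV[R]_#|{set 'I_(p + q)}|.

HB.instance Definition _ (R : realType) (p q : nat) :=
  NormedModule.on (clifford R p q).

Section CliffordAlgebra.
Variables (R : realType) (p q : nat).
Local Notation idx := 'I_(p + q).
Local Notation Cl := (clifford R p q).
Implicit Types (A B C : Cl) (S T U : {set idx}).

Definition coef A S : R := (A : 'rV[R]_#|{set idx}|) 0 (enum_rank S).

Definition blade S : Cl := delta_mx 0 (enum_rank S).

Definition clifford_mul A B : Cl :=
  \sum_S \sum_T (coef A S * coef B T * blade_sign R S T)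
                  *: blade (symdiff S T).

Definition clifford_one : Cl := blade finset.set0.

Lemma coefD A B S : coef (A + B) S = coef A S + coef B S.
Proof. by rewrite /coef mxE. Qed.

Lemma coefZ c A S : coef (c *: A) S = c * coef A S.
Proof. by rewrite /coef mxE. Qed.

Lemma coef_blade S T : coef (blade S) T = (T == S)%:R.
Proof. by rewrite /coef /blade mxE eqxx /= (inj_eq enum_rank_inj). Qed.

Lemma clifford_decomp A : A = \sum_S coef A S *: blade S.
Proof.
rewrite {1}[A](row_sum_delta (A : 'rV[R]__)) (reindex (@enum_rank {set idx})) //.
by exists enum_val => ? _; rewrite ?enum_rankK ?enum_valK.
Qed.

Lemma clifford_mulDl : left_distributive clifford_mul +%R.
Proof.
move=> A B C; rewrite -big_split; apply: eq_bigr => S _ /=.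
rewrite -big_split; apply: eq_bigr => T _ /=.
by rewrite coefD !mulrDl scalerDl.
Qed.

Lemma clifford_mulDr : right_distributive clifford_mul +%R.
Proof.
move=> A B C; rewrite -big_split; apply: eq_bigr => S _ /=.
rewrite -big_split; apply: eq_bigr => T _ /=.
by rewrite coefD mulrDr !mulrDl scalerDl.
Qed.

Lemma clifford_scaleAl c A B : c *: clifford_mul A B = clifford_mul (c *: A) B.
Proof.
rewrite scaler_sumr; apply: eq_bigr => S _.
rewrite scaler_sumr; apply: eq_bigr => T _.
by rewrite coefZ scalerA !mulrA.
Qed.

Lemma clifford_scaleAr c A B : c *: clifford_mul A B = clifford_mul A (c *: B).
Proof.
rewrite scaler_sumr; apply: eq_bigr => S _.
rewrite scaler_sumr; apply: eq_bigr => T _.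
by rewrite coefZ scalerA !mulrA [c * _]mulrC.
Qed.

Lemma clifford_mul0l A : clifford_mul 0 A = 0.
Proof. by have := clifford_scaleAl 0 0 A; rewrite !scale0r. Qed.

Lemma clifford_mul0r A : clifford_mul A 0 = 0.
Proof. by have := clifford_scaleAr 0 A 0; rewrite !scale0r. Qed.

Lemma clifford_mul_suml (I : finType) (F : I -> Cl) B :
  clifford_mul (\sum_i F i) B = \sum_i clifford_mul (F i) B.
Proof.
by apply: (big_morph (clifford_mul^~ B)) => [A C|];
  rewrite ?clifford_mulDl ?clifford_mul0l.
Qed.

Lemma clifford_mul_sumr (I : finType) (F : I -> Cl) A :
  clifford_mul A (\sum_i F i) = \sum_i clifford_mul A (F i).
Proof.
by apply: (big_morph (clifford_mul A)) => [B C|];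
  rewrite ?clifford_mulDr ?clifford_mul0r.
Qed.

Lemma clifford_mul_blade S T :
  clifford_mul (blade S) (blade T) = blade_sign R S T *: blade (symdiff S T).
Proof.
rewrite /clifford_mul (bigD1 S) //= (bigD1 T) //= !coef_blade !eqxx !mul1r.
rewrite [X in _ + X + _]big1; last first.
  by move=> V /negbTE nV; rewrite coef_blade nV mulr0 mul0r scale0r.
rewrite addr0 [X in _ + X]big1 ?addr0 // => V /negbTE nV.
by rewrite big1 // => W _; rewrite coef_blade nV !mul0r scale0r.
Qed.

Lemma clifford_mul_bladeA S T U :
  clifford_mul (blade S) (clifford_mul (blade T) (blade U)) =
  clifford_mul (clifford_mul (blade S) (blade T)) (blade U).
Proof.
rewrite !clifford_mul_blade -clifford_scaleAr -clifford_scaleAl.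
rewrite !clifford_mul_blade symdiffA !scalerA.
by rewrite blade_sign_symdiffl blade_sign_symdiffr mulrC mulrA.
Qed.

Lemma clifford_mul_decompl A B :
  clifford_mul A B = \sum_S coef A S *: clifford_mul (blade S) B.
Proof.
rewrite {1}(clifford_decomp A) clifford_mul_suml.
by apply: eq_bigr => S _; rewrite clifford_scaleAl.
Qed.

Lemma clifford_mul_decompr A B :
  clifford_mul A B = \sum_S coef B S *: clifford_mul A (blade S).
Proof.
rewrite {1}(clifford_decomp B) clifford_mul_sumr.
by apply: eq_bigr => S _; rewrite clifford_scaleAr.
Qed.

Lemma clifford_mulA : associative clifford_mul.
Proof.
move=> A B C; rewrite (clifford_mul_decompl A (clifford_mul B C)).
rewrite (clifford_mul_decompl A B) clifford_mul_suml; apply: eq_bigr => S _.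
rewrite -clifford_scaleAl; congr (_ *: _).
rewrite (clifford_mul_decompl B C) clifford_mul_sumr.
rewrite (clifford_mul_decompr _ B) clifford_mul_suml; apply: eq_bigr => T _.
rewrite -clifford_scaleAl -clifford_scaleAr; congr (_ *: _).
rewrite (clifford_mul_decompr _ C) clifford_mul_sumr.
rewrite (clifford_mul_decompr _ C); apply: eq_bigr => U _.
by rewrite -clifford_scaleAr clifford_mul_bladeA.
Qed.

Lemma clifford_mul1l : left_id clifford_one clifford_mul.
Proof.
move=> A; rewrite {1}(clifford_decomp A) clifford_mul_sumr [RHS]clifford_decomp.
apply: eq_bigr => S _.
by rewrite -clifford_scaleAr clifford_mul_blade symdiff0s blade_sign0s scale1r.
Qed.

Lemma clifford_mul1r : right_id clifford_one clifford_mul.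
Proof.
move=> A; rewrite {1}(clifford_decomp A) clifford_mul_suml [RHS]clifford_decomp.
apply: eq_bigr => S _.
by rewrite -clifford_scaleAl clifford_mul_blade symdiffs0 blade_signs0 scale1r.
Qed.

Lemma clifford_one_neq0 : clifford_one != 0.
Proof.
apply/eqP => /(congr1 (coef^~ finset.set0)); rewrite coef_blade eqxx.
by rewrite /coef mxE => /eqP; rewrite oner_eq0.
Qed.

End CliffordAlgebra.

HB.instance Definition _ (R : realType) (p q : nat) :=
  GRing.Zmodule_isNzRing.Build (clifford R p q)
    (@clifford_mulA R p q) (@clifford_mul1l R p q) (@clifford_mul1r R p q)
    (@clifford_mulDl R p q) (@clifford_mulDr R p q) (@clifford_one_neq0 R p q).
HB.instance Definition _ (R : realType) (p q : nat) :=
  GRing.Lmodule_isLalgebra.Build R (clifford R p q) (@clifford_scaleAl R p q).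
HB.instance Definition _ (R : realType) (p q : nat) :=
  GRing.Lalgebra_isAlgebra.Build R (clifford R p q) (@clifford_scaleAr R p q).

Section CliffordTheory.
Variables (R : realType) (p q : nat).
Local Notation idx := 'I_(p + q).
Local Notation Cl := (clifford R p q).

Definition gen (j : idx) : Cl := blade R [set j]%SET.

Lemma mul_blade (S T : {set idx}) :
  (blade R S : Cl) * blade R T = blade_sign R S T *: blade R (symdiff S T).
Proof. exact: clifford_mul_blade. Qed.

Lemma gen_sqr j : gen j * gen j = (signature R j)%:A.
Proof.
by rewrite mul_blade symdiffss blade_sign11 /pair_sign ltnn eqxx.
Qed.

Lemma gen_anticomm j k :
  gen j * gen k + gen k * gen j = (2 * signature R j * (j == k)%:R)%:A.
Proof.
have [<-|jk] := eqVneq j k.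
  by rewrite gen_sqr -scalerDl mulr1 mulrDl !mul1r.
rewrite !mul_blade !blade_sign11 /pair_sign [k == j]eq_sym (negbTE jk).
rewrite mulr0 scale0r.
have -> : symdiff [set k]%SET [set j]%SET = symdiff [set j]%SET [set k]%SET.
  by apply/setP => i; rewrite !in_symdiff addbC.
case: (ltngtP k j) => [_|_|/val_inj kj]; last by rewrite kj eqxx in jk.
  by rewrite scaleN1r scale1r addNr.
by rewrite scaleN1r scale1r subrr.
Qed.

Lemma blade_genE (S : {set idx}) :
  (blade R S : Cl) = \prod_(j < p + q | j \in S) gen j.
Proof.
suff H (s : seq idx) : sorted (fun i j : idx => (i < j)%N) s ->
    (blade R [set j in s]%SET : Cl) = \prod_(j <- s) gen j.
  rewrite -big_filter -H; last first.
    apply: sorted_filter; first by move=> ? ? ?; exact: ltn_trans.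
    by rewrite /index_enum -enumT -(@sorted_map _ _ val ltn) val_enum_ord iota_ltn_sorted.
  by congr (blade R _); apply/setP => j; rewrite inE mem_filter mem_index_enum andbT.
elim: s => [_|i s IH /= si]; first by rewrite big_nil; congr (blade R _);
  apply/setP => j; rewrite !inE.
have /allP is_min : all (fun j : idx => (i < j)%N) s.
  by apply: order_path_min si => ? ? ?; exact: ltn_trans.
have i_notin : i \notin s by apply/negP => /is_min; rewrite ltnn.
rewrite big_cons -IH ?(path_sorted si) // mul_blade.
have -> : blade_sign R [set i]%SET [set j in s]%SET = 1.
  rewrite /blade_sign big_set1 big1 // => j; rewrite inE => /is_min ij.
  rewrite /pair_sign ltnNge ltnW //=; case: eqP => // ji.
  by rewrite ji ltnn in ij.
rewrite scale1r; congr (blade R _); apply/setP => j.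
rewrite in_symdiff !inE; case: eqP => // ->.
by rewrite (negbTE i_notin).
Qed.

Lemma clifford_dim : #|{set idx}| = (2 ^ (p + q))%N.
Proof. by rewrite -cardsT -powersetT card_powerset cardsT card_ord. Qed.

Definition clifford_exp (A : Cl) : Cl :=
  limn (series (fun k : nat => (k`!%:R : R)^-1 *: A ^+ k)).

Definition geometric_imaginary : set Cl :=
  [set i | i = 0 \/ exists2 r : R, r < 0 & i ^+ 2 = r%:A].

End CliffordTheory.
Arguments geometric_imaginary : clear implicits.

Section LebesgueMeasure.
Variables (R : realType) (m : nat).
Local Notation E := 'rV[R]_m.
Implicit Types (a b : E) (X : set E).
Local Open Scope ereal_scope.

Definition box a b : set E :=
  [set x | forall i, (a 0 i <= x 0 i <= b 0 i)%R].

(* The empty set allows finite covers; it matters when m = 0, where the only box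
   is the whole space, of volume 1. *)
Definition elementary X (v : \bar R) : Prop :=
  (X = set0 /\ v = 0) \/
  exists a b, [/\ forall i, (a 0 i <= b 0 i)%R, X = box a b &
                  v = (\prod_i (b 0 i - a 0 i))%:E].

Definition elementary_cover X (C : nat -> set E) (v : nat -> \bar R) : Prop :=
  (forall k, elementary (C k) (v k)) /\ X `<=` \bigcup_k C k.

Definition lebesgue_outer X : \bar R :=
  ereal_inf [set s | exists C v, elementary_cover X C v /\ s = \sum_(k <oo) v k].

Lemma elementary_ge0 X v : elementary X v -> 0 <= v.
Proof.
move=> [[_ ->]//|[a [b [ab _ ->]]]].
by rewrite lee_fin prodr_ge0 // => i _; rewrite subr_ge0.
Qed.

Lemma lebesgue_outer_ge0 X : 0 <= lebesgue_outer X.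
Proof.
apply: le_ereal_inf_tmp => _ [C [v [[Cv _] ->]]].
by apply: nneseries_ge0 => k _ _; apply: elementary_ge0 (Cv k).
Qed.

Lemma lebesgue_outer0 : lebesgue_outer set0 = 0.
Proof.
apply/eqP; rewrite eq_le lebesgue_outer_ge0 andbT.
apply: ereal_inf_lbound; exists (fun=> set0), (fun=> 0); split.
  by split => // k; left.
by rewrite eseries0.
Qed.

Lemma le_lebesgue_outer :
  {homo lebesgue_outer : X Y / X `<=` Y >-> X <= Y}.
Proof.
move=> X Y XY; apply: ereal_inf_le_tmp => _ [C [v [[Cv YC] ->]]].
by exists C, v; split => //; split => //; apply: subset_trans YC.
Qed.

Lemma lebesgue_outer_sigma_subadditive : sigma_subadditive lebesgue_outer.
Proof.
move=> A; have [[i ioo]|] := pselect (exists i, lebesgue_outer (A i) = +oo).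
  rewrite (eseries_pinfty _ _ ioo) ?leey // => n _.
  by rewrite -ltNye (lt_le_trans _ (lebesgue_outer_ge0 _)).
rewrite -forallNE => Aoo.
suff add2e (e : {posnum R}) : lebesgue_outer (\bigcup_n A n) <=
    \sum_(i <oo) lebesgue_outer (A i) + e%:num%:E.
  by apply/lee_addgt0Pr => _/posnumP[].
rewrite (le_trans _ (epsilon_trick _ _ _)) //; last first.
  by move=> n; exact: lebesgue_outer_ge0.
pose P n (G : (nat -> set E) * (nat -> \bar R)) :=
  elementary_cover (A n) G.1 G.2 /\
  \sum_(k <oo) G.2 k <= lebesgue_outer (A n) + (e%:num / (2 ^ n.+1)%:R)%:E.
have [G PG] : {G & forall n, P n (G n)}.
  apply: (@choice _ _ P) => n.
  have en : (0 < e%:num / (2 ^ n.+1)%:R :> R)%R by [].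
  have fA : lebesgue_outer (A n) \is a fin_num.
    by rewrite ge0_fin_numE ?lebesgue_outer_ge0 // ltey; apply/eqP.
  have [_ [C [v [Cv ->]]] /ltW lev] := lb_ereal_inf_adherent en fA.
  by exists (C, v).
pose w (x : nat * nat) := (G x.1).2 x.2.
have w0 x : 0 <= w x by apply: elementary_ge0 ((PG x.1).1.1 x.2).
apply: (@le_trans _ _ (\esum_(x in setT) w x)).
  apply: ereal_inf_lbound.
  have /card_esym/ppcard_eqP[f] := card_nat2.
  exists (fun k => (G (f k).1).1 (f k).2), (w \o f); split.
    split => [k|t [n _ Ant]]; first exact: (PG _).1.1.
    have [k _ Ckt] := (PG n).1.2 t Ant.
    by exists (f^-1%FUN (n, k)) => //; rewrite invK ?inE.
  rewrite -(esum_pred_image w f xpredT) //; last first.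
    by move=> ? ? _ _; exact: bij_inj.
  congr esum.
  apply/seteqP; split=> // x _.
  by exists (f^-1%FUN x) => //; rewrite invK ?inE.
rewrite (_ : esum _ _ = \sum_(n <oo) \sum_(k <oo) w (n, k)).
  apply: lee_nneseries => [n _ _|n _]; last exact: (PG n).2.
  by apply: nneseries_ge0.
pose J (n : nat) : set (nat * nat) := [set (n, k) | k in setT].
rewrite (_ : setT = \bigcup_n J n); last first.
  by rewrite predeqE => -[n k]; split => // _; exists n => //; exists k.
rewrite esum_bigcupT //=; last first.
  apply/trivIsetP => i j _ _ ij; rewrite predeqE => -[n k] /=; split => //=.
  by move=> -[] [_] _ [<-{n} _] [k' _] [] /esym/eqP; rewrite (negbTE ij).
rewrite -(image_id [set: nat]) -fun_true esum_pred_image //; last first.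
  by move=> n _; exact: esum_ge0.
apply: eq_eseriesr => n _.
rewrite -(esum_pred_image w (pair n) predT) //=; last first.
  by move=> ? ? _ _; exact: (@can_inj _ _ _ snd).
by congr esum; rewrite predeqE => -[a b]; split; move=> [k _ <-]; exists k.
Qed.

HB.instance Definition _ := isOuterMeasure.Build R E lebesgue_outer
  lebesgue_outer0 lebesgue_outer_ge0 le_lebesgue_outer
  lebesgue_outer_sigma_subadditive.

Definition lebesgue_outer_measure : {outer_measure set E -> \bar R} :=
  lebesgue_outer.

(* Defined on the sigma-algebra of all Lebesgue measurable sets, i.e. those
   satisfying Caratheodory's criterion. *)
Definition lebesgue_measure_rV :
    {measure set (caratheodory_type lebesgue_outer_measure) -> \bar R} :=
  lebesgue_outer_measure : set (caratheodory_type lebesgue_outer_measure) -> _.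

End LebesgueMeasure.

Section GeometricFourierTransform.
Variables (R : realType) (p q m mu rho : nat).
Local Notation E := 'rV[R]_m.
Local Notation Cl := (clifford R p q).
Variables (F1 : 'I_mu -> E -> E -> Cl) (F2 : 'I_rho -> E -> E -> Cl).
Variable A : E -> Cl.

Definition gft_integrand (u x : E) : Cl :=
  (\prod_(k < mu) clifford_exp (- F1 k x u)) * A x *
  (\prod_(k < rho) clifford_exp (- F2 k x u)).

(* Integrals of multivector fields are taken coordinatewise. *)
Definition gft_exists (u : E) : Prop := forall S : {set 'I_(p + q)},
  (@lebesgue_measure_rV R m).-integrable setT
    (fun x => (coef (gft_integrand u x) S)%:E).

Definition gft (u : E) : Cl :=
  \sum_S (\int[@lebesgue_measure_rV R m]_(x in setT)
             coef (gft_integrand u x) S) *: blade R S.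

End GeometricFourierTransform.

(* Main.v *)
Require Import Defs.
From mathcomp Require Import all_boot all_order all_algebra.
From mathcomp Require Import all_classical all_reals all_analysis.
From mathcomp Require Import measurable_realfun.
Import Order.TTheory GRing.Theory Num.Theory.
Import numFieldNormedType.Exports.
Local Open Scope classical_set_scope.
Local Open Scope ring_scope.

(** Bilinearity gives [f (x, u) = f (a x, u / a)] for every exponent [f], so the
    integrand of the transform of [A] at [u] is the integrand of the transform
    of [B] at [u / a], composed with the dilation [x |-> a x]
    ([gft_integrand_dilation]). The factor [|a| ^- m] is then the Jacobian of
    the dilation ([Rintegral_dilation]).

    This change of variables goes back to the definition of Lebesgue measure by
    covers with boxes. A dilation pulls a box back to a box whose volume is
    multiplied by [|a| ^- m] ([elementary_dilation]), so it pulls a cover back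
    to a cover and scales the outer measure by [|a| ^- m]
    ([lebesgue_outer_dilation]); two applications, to [a] and to its inverse,
    turn the obvious inequality into an equality. Since the dilation is
    bijective, Caratheodory's criterion transfers along it, which makes it a
    measurable map whose pushforward of Lebesgue measure is Lebesgue measure
    scaled by [|a| ^- m]. *)

Local Notation lebesgue_rV R m :=
  (caratheodory_type (@lebesgue_outer_measure R m)).

Section DilationMeasure.
Context {R : realType} {m : nat}.
Local Notation E := 'rV[R]_m.
Implicit Types (c : R) (X : set E).

Lemma dilation_preimageK c c' X : c' * c = 1 ->
  GRing.scale c @^-1` (GRing.scale c' @^-1` X) = X.
Proof.
by move=> cc'; apply/seteqP; split=> x /=; rewrite scalerA cc' scale1r.
Qed.

(** A negative dilation exchanges the two corners of a box. *)
Lemma elementary_dilation c X v : c != 0 -> elementary X v ->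
  elementary (GRing.scale c @^-1` X) ((`|c| ^- m)%:E * v)%E.
Proof.
move=> c0 [[-> ->]|[l [h [lh -> ->]]]].
  by left; rewrite preimage_set0 mule0.
right; exists (c^-1 *: (if 0 < c then l else h)).
exists (c^-1 *: (if 0 < c then h else l)).
have [cp|cn] := ltrP 0 c.
  split.
  - by move=> i; rewrite !mxE ler_pM2l ?invr_gt0.
  - apply/seteqP; split=> x /= H i; have := H i;
      by rewrite !mxE ler_pdivrMl // ler_pdivlMl.
  rewrite -EFinM; congr EFin; rewrite gtr0_norm // -exprVn.
  rewrite -[X in _ ^+ X](card_ord m) -prodr_const -big_split /=.
  by apply: eq_bigr => i _; rewrite !mxE mulrBr.
have {}cn : c < 0 by rewrite lt_neqAle c0.
split.
- by move=> i; rewrite !mxE ler_nM2l ?invr_lt0.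
- apply/seteqP; split=> x /= H i; have := H i;
    by rewrite !mxE ler_ndivrMl // ler_ndivlMl // andbC.
rewrite -EFinM; congr EFin; rewrite ltr0_norm // -exprVn.
rewrite -[X in _ ^+ X](card_ord m) -prodr_const -big_split /=.
by apply: eq_bigr => i _; rewrite !mxE invrN mulNr -mulrN opprB mulrBr.
Qed.

Lemma le_lebesgue_outer_dilation c X : c != 0 ->
  (lebesgue_outer (GRing.scale c @^-1` X) <=
   (`|c| ^- m)%:E * lebesgue_outer X)%E.
Proof.
move=> c0; have k0 : 0 < `|c| ^- m by rewrite invr_gt0 exprn_gt0 ?normr_gt0.
rewrite -lee_pdivrMl //; apply: le_ereal_inf_tmp => _ [C [v [[Cv XC] ->]]].
rewrite lee_pdivrMl // -nneseriesZl; last first.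
  by move=> k _; apply: elementary_ge0 (Cv k).
apply: ereal_inf_lbound.
exists (fun k => GRing.scale c @^-1` C k), (fun k => (`|c| ^- m)%:E * v k)%E.
split=> //; split=> [k|x Xx]; first exact: elementary_dilation.
by have [k _ Ck] := XC _ Xx; exists k.
Qed.

(** The reverse inequality is the previous one for the inverse dilation, which
    brings the preimage of [X] back to [X]. *)
Lemma lebesgue_outer_dilation c X : c != 0 ->
  (lebesgue_outer (GRing.scale c @^-1` X) =
   (`|c| ^- m)%:E * lebesgue_outer X)%E.
Proof.
move=> c0; apply/eqP; rewrite eq_le le_lebesgue_outer_dilation //=.
have k0 : 0 < `|c| ^- m by rewrite invr_gt0 exprn_gt0 ?normr_gt0.
rewrite -lee_pdivlMl //.
have := @le_lebesgue_outer_dilation c^-1 (GRing.scale c @^-1` X).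
rewrite dilation_preimageK ?divff // normfV exprVn invr_eq0; exact.
Qed.

(** A dilation is bijective, so every set is a preimage and the preimage of [X]
    can be tested against preimages only; this scales both sides of the criterion
    for [X] by the same factor. *)
Lemma caratheodory_dilation c X : c != 0 ->
  (@lebesgue_outer R m).-caratheodory X ->
  (@lebesgue_outer R m).-caratheodory (GRing.scale c @^-1` X).
Proof.
move=> c0 mX Y; rewrite -[Y](@dilation_preimageK c c^-1) ?mulVf //.
move: (GRing.scale c^-1 @^-1` Y) => Z.
rewrite (lebesgue_outer_dilation c Z c0) (mX Z) ge0_muleDr ?lebesgue_outer_ge0 //.
have ZX := lebesgue_outer_dilation c (Z `&` X) c0.
have ZXC := lebesgue_outer_dilation c (Z `&` ~` X) c0.
by rewrite -ZX -ZXC.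
Qed.

Lemma measurable_dilation c : c != 0 ->
  measurable_fun [set: lebesgue_rV R m] (GRing.scale c : _ -> lebesgue_rV R m).
Proof. by move=> c0 _ X mX; rewrite setTI; exact: caratheodory_dilation. Qed.

End DilationMeasure.

Lemma integral_mscale d (T : measurableType d) (R : realType)
    (mu : {measure set T -> \bar R}) (D : set T) (k : {nonneg R})
    (f : T -> \bar R) : measurable D -> mu.-integrable D f ->
  (\int[mscale k mu]_(x in D) f x = k%:num%:E * \int[mu]_(x in D) f x)%E.
Proof.
move=> mD fi; have mf := measurable_int _ fi.
have neg_fin := integrable_neg_fin_num mD fi.
rewrite [LHS]integralE (ge0_integral_mscale mu mD k (measurable_funepos mf)) //.
rewrite (ge0_integral_mscale mu mD k (measurable_funeneg mf)) //.
rewrite [in RHS]integralE.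
by apply/esym/muleBr; rewrite // fin_num_adde_defl // fin_numN.
Qed.

Lemma Rintegral_dilation (R : realType) (m : nat) (c : R)
    (f : 'rV[R]_m -> R) (mu := @lebesgue_measure_rV R m) : c != 0 ->
  mu.-integrable setT (EFin \o f) ->
  mu.-integrable setT (EFin \o (f \o GRing.scale c)) ->
  \int[mu]_x f (c *: x) = `|c| ^- m * \int[mu]_x f x.
Proof.
move=> c0 fi fci.
have k0 : 0 <= `|c| ^- m by rewrite invr_ge0 exprn_ge0.
have mf := measurable_int _ fi.
(* The outer measure scales on all sets, measurable or not, so the two measures
   agree as plain set functions. *)
have pushforwardE :
    pushforward mu (GRing.scale c : lebesgue_rV R m -> lebesgue_rV R m) =
    mscale (NngNum k0) mu.
  by apply/funext => X; exact: lebesgue_outer_dilation.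
have := integral_pushforward (measurable_dilation c c0) mf fci measurableT.
rewrite preimage_setT pushforwardE integral_mscale // /Rintegral => <-.
by rewrite fineM //; exact: integrable_fin_num.
Qed.

Lemma bilinear_swap_scale (R : fieldType) (U V W : lmodType R)
    (f : U -> V -> W) (c : R) (x : U) (u : V) :
  bilinear_for *:%R *:%R f -> c != 0 -> f (c *: x) (c^-1 *: u) = f x u.
Proof.
move=> [fl fr] c0.
have Zl z y w : f (z *: y) w = z *: f y w.
  exact: (GRing.scalable_linear (fl w)).
have Zr z y w : f y (z *: w) = z *: f y w.
  exact: (GRing.scalable_linear (fr y)).
by rewrite Zl Zr scalerA divff // scale1r.
Qed.

Lemma gft_integrand_dilation (R : realType) (p q m mu rho : nat)
    (F1 : 'I_mu -> 'rV[R]_m -> 'rV[R]_m -> clifford R p q)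
    (F2 : 'I_rho -> 'rV[R]_m -> 'rV[R]_m -> clifford R p q)
    (A B : 'rV[R]_m -> clifford R p q) (a : R) (u x : 'rV[R]_m) :
  (forall k, bilinear_for *:%R *:%R (F1 k)) ->
  (forall k, bilinear_for *:%R *:%R (F2 k)) ->
  a != 0 -> A x = B (a *: x) ->
  gft_integrand F1 F2 A u x = gft_integrand F1 F2 B (a^-1 *: u) (a *: x).
Proof.
move=> F1_bil F2_bil a0 AB; rewrite /gft_integrand AB.
have swap_prod n (F : 'I_n -> 'rV[R]_m -> 'rV[R]_m -> clifford R p q) :
    (forall k, bilinear_for *:%R *:%R (F k)) ->
    \prod_(k < n) clifford_exp (- F k x u) =
    \prod_(k < n) clifford_exp (- F k (a *: x) (a^-1 *: u)).
  move=> F_bil; apply: eq_bigr => k _.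
  by rewrite (bilinear_swap_scale _ _ _ _ _ _ _ _ (F_bil k) a0).
exact: (congr2 (fun P Q => P * B (a *: x) * Q)
  (swap_prod _ _ F1_bil) (swap_prod _ _ F2_bil)).
Qed.

Theorem theorem4p1 (R : realType) (p q m mu rho : nat)
    (F1 : 'I_mu -> 'rV[R]_m -> 'rV[R]_m -> clifford R p q)
    (F2 : 'I_rho -> 'rV[R]_m -> 'rV[R]_m -> clifford R p q)
    (F1_imag : forall k x u, geometric_imaginary R p q (F1 k x u))
    (F2_imag : forall k x u, geometric_imaginary R p q (F2 k x u))
    (F1_bilinear : forall k, bilinear_for *:%R *:%R (F1 k))
    (F2_bilinear : forall k, bilinear_for *:%R *:%R (F2 k))
    (a : R) (a_neq0 : a != 0)
    (A B : 'rV[R]_m -> clifford R p q)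
    (AB : forall x, A x = B (a *: x))
    (gftA_exists : forall u, gft_exists F1 F2 A u)
    (gftB_exists : forall u, gft_exists F1 F2 B u) :
  forall u : 'rV[R]_m,
    gft F1 F2 A u = `|a| ^- m *: gft F1 F2 B (a^-1 *: u).
Proof.
move=> u; rewrite /gft scaler_sumr; apply: eq_bigr => S _; rewrite scalerA.
apply: (congr1 ( *:%R^~ (blade R S))).
pose g x := coef (gft_integrand F1 F2 B (a^-1 *: u) x) S.
have coefE : (fun x => coef (gft_integrand F1 F2 A u x) S) = g \o GRing.scale a.
  apply/funext => x; apply: (congr1 (fun y => coef y S)).
  exact: (gft_integrand_dilation _ _ _ _ _ _ F1 F2 A B a u x
    F1_bilinear F2_bilinear a_neq0 (AB x)).
have gB : (@lebesgue_measure_rV R m).-integrable setT (EFin \o g).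
  exact: gftB_exists.
have gA : (@lebesgue_measure_rV R m).-integrable setT
    (EFin \o (g \o GRing.scale a)).
  by rewrite -coefE; exact: gftA_exists.
rewrite -[RHS](Rintegral_dilation R m a g a_neq0 gB gA).
exact: (congr1 (Rintegral (@lebesgue_measure_rV R m) setT) coefE).
Qed.
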